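(* Let $s\ge 1$ and $d\ge 1$ be integers. There exists a non-adaptive one-sided error tester for the property ''$s$-binary rank at most $d$'' of $n\times m$ $(0,1)$-matrices that makes $O(T\log T)=\tilde O\!\left(\binom{d}{\le s}2^d/\epsilon^2\right)$ queries, where $T=324\,d^2\binom{d}{\le s}2^d/\epsilon^2$. The same query bound is achievable by a non-adaptive one-sided error tester for the property ''$s$-binary rank exactly $d$''.
   Context: For a $(0,1)$-matrix $M$ of size $n\times m$, $M[i,j]$ denotes its $(i,j)$ entry and $[n]=\{1,\dots,n\}$. The $s$-binary rank ${\rm br}_s(M)$ is the minimal integer $d\ge 0$ such that there exist $d$ sets (rectangles) $I_k\times J_k$ with $I_k\subseteq[n]$, $J_k\subseteq[m]$, $k\in[d]$, with $M[i,j]=1$ for all $(i,j)\in I_k\times J_k$ and all $k$, and such that every $(i,j)$ with $M[i,j]=1$ lies in at least one and at most $s$ of the rectangles. $\binom{d}{\le s}=\sum_{i=0}^{s}\binom{d}{i}$. A matrix $M$ is $\epsilon$-far from a property if more than an $\epsilon$-fraction of its $nm$ entries must be modified to obtain a matrix with the property. A tester receives $0<\epsilon<1$, $d,s,n,m$ and query access to the entries of $M$; if $M$ has the property it accepts with probability at least $2/3$, and if $M$ is $\epsilon$-far from the property it rejects with probability at least $2/3$. It is one-sided if it accepts matrices with the property with probability $1$. It is non-adaptive if all its queries are fixed in advance (possibly using randomness) before any answer is seen. $\tilde O$ hides factors polylogarithmic in $\binom{d}{\le s}2^d$ and $1/\epsilon$. *)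

(* Defs.v *)
From Stdlib Require Import Reals.
From HB Require Import structures.
From mathcomp Require Import all_boot all_order all_algebra.
From mathcomp Require Import Rstruct.
Set Implicit Arguments. Unset Strict Implicit. Unset Printing Implicit Defensive.
Import Order.TTheory GRing.Theory Num.Theory.
Local Open Scope ring_scope.

Definition bmatrix (n m : nat) := 'I_n -> 'I_m -> bool.

Definition s_cover (n m s d : nat) (M : bmatrix n m)
  (I : 'I_d -> {set 'I_n}) (J : 'I_d -> {set 'I_m}) : Prop :=
  (forall k i j, i \in I k -> j \in J k -> M i j) /\
  (forall i j, M i j ->
     let c := #|[set k | (i \in I k) && (j \in J k)]| in ((1 <= c)%N && (c <= s)%N)).

Definition has_s_cover (n m s d : nat) (M : bmatrix n m) : Prop :=
  exists I J, @s_cover n m s d M I J.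

Definition brs_le (n m s d : nat) (M : bmatrix n m) : Prop :=
  exists d', (d' <= d)%N /\ has_s_cover s d' M.

Definition brs_eq (n m s d : nat) (M : bmatrix n m) : Prop :=
  has_s_cover s d M /\ forall d', (d' < d)%N -> ~ has_s_cover s d' M.

Definition hamming (n m : nat) (M M' : bmatrix n m) : nat :=
  #|[set p : 'I_n * 'I_m | M p.1 p.2 != M' p.1 p.2]|.

Definition far (n m : nat) (P : bmatrix n m -> Prop) (eps : R) (M : bmatrix n m) : Prop :=
  forall M', P M' -> eps * (n * m)%:R < (hamming M M')%:R.

(* A non-adaptive randomized tester on n x m matrices: a finite probability
   space 'I_K with weights w; for each outcome k, the query sequence Q k is
   fixed before any answer is seen, and the decision D k depends only on k
   and the answers to those queries. *)
Record tester (n m : nat) := Tester {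
  t_K : nat;
  t_w : 'I_t_K -> R;
  t_Q : 'I_t_K -> seq ('I_n * 'I_m);
  t_D : 'I_t_K -> seq bool -> bool }.
Arguments t_K {n m} t.
Arguments t_w {n m} t k.
Arguments t_Q {n m} t k.
Arguments t_D {n m} t k _.

Definition tester_valid (n m : nat) (T : tester n m) : Prop :=
  (forall k, 0 <= t_w T k) /\ \sum_(k < t_K T) t_w T k = 1.

Definition answers (n m : nat) (M : bmatrix n m) (q : seq ('I_n * 'I_m)) : seq bool :=
  map (fun p => M p.1 p.2) q.

Definition accept_prob (n m : nat) (T : tester n m) (M : bmatrix n m) : R :=
  \sum_(k < t_K T | t_D T k (answers M (t_Q T k))) t_w T k.

Definition queries_le (n m : nat) (T : tester n m) (q : R) : Prop :=
  forall k, (size (t_Q T k))%:R <= q.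

Definition one_sided_tester (n m : nat) (P : bmatrix n m -> Prop) (eps : R)
  (T : tester n m) : Prop :=
  tester_valid T /\
  (forall M, P M -> accept_prob T M = 1) /\
  (forall M, far P eps M -> accept_prob T M <= 1 / 3).

Definition binom_le (d s : nat) : nat := \sum_(i < s.+1) 'C(d, i).

Definition Tbound (d s : nat) (eps : R) : R :=
  324 * (d ^ 2 * binom_le d s * 2 ^ d)%:R / eps ^+ 2.

(* Main.v *)
(** Lay the random rows and columns out in blocks of length O(d/eps) and query
    the entries in row block [a] and column block [b] whenever [a * b <= w], with
    [w = 4 binom_le d s 2^d]; this hyperbola has O(w log w) block pairs.

    Grow a submatrix [X * Y] without repeated rows or columns, spending one row
    block per new row and one column block per new column. As long as it has an
    [s]-cover of size [d], its rows and columns are distinct subsets of [d]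
    rectangles with pairwise intersections of size at most [s], and Sgall's bound
    gives [|X||Y| <= binom_le d s 2^d], so the queries suffice for the next step.
    If few rows or columns make it grow, copying the values of [X * Y] to all
    rows and columns yields a matrix of small rank close to [M].

    If some matrix has rank exactly [d], planting a [d * d] identity row by row in
    a matrix of rank at most [d] produces one of rank exactly [d] after at most
    [d^2] changes, which are negligible unless [n m = O(d^2/eps)]. *)

Require Import Defs.
From Stdlib Require Import Reals.
From HB Require Import structures.
From mathcomp Require Import all_boot all_order all_algebra.
From mathcomp Require Import Rstruct boolp ring lra zify.
Import Order.TTheory GRing.Theory Num.Theory.
Local Open Scope ring_scope.
Set Implicit Arguments. Unset Strict Implicit. Unset Printing Implicit Defensive.

(** * Sgall's bound *)

Lemma binom_le0n s : binom_le 0 s = 1%N.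
Proof.
by rewrite /binom_le big_ord_recl /= big1 ?addn0 // => i _; rewrite bin0n.
Qed.

Lemma binom_len0 d : binom_le d 0 = 1%N.
Proof. by rewrite /binom_le big_ord1 bin0. Qed.

Lemma binom_leSS d s :
  binom_le d.+1 s.+1 = (binom_le d s.+1 + binom_le d s)%N.
Proof.
rewrite /binom_le big_ord_recl [in RHS]big_ord_recl !bin0 -addnA.
by rewrite -big_split /=; congr (_ + _)%N.
Qed.

Section Sgall.
Variable T : finType.
Implicit Types (F G H : {set {set T}}) (D x y : {set T}) (e : T).

Definition shadow_union e F : {set {set T}} := [set x :\ e | x in F].
Definition shadow_inter e F : {set {set T}} :=
  [set x in F | (e \notin x) && (e |: x \in F)].

(** Removing [e] merges at most two members of [F]: the first shadow counts each merged set once,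
    the second counts the doubly hit ones again. *)
Lemma card_shadows e F : #|F| = (#|shadow_union e F| + #|shadow_inter e F|)%N.
Proof.
pose F0 := [set x in F | e \notin x]; pose F1 := F :\: F0.
pose F1' := [set x :\ e | x in F1].
have F1P x : (x \in F1) = (x \in F) && (e \in x).
  by rewrite !inE; case: (x \in F); case: (e \in x).
have card1 : #|F1'| = #|F1|.
  apply: card_in_imset => x y; rewrite !F1P => /andP[_ ex] /andP[_ ey] eq_xy.
  by rewrite -(setD1K ex) eq_xy setD1K.
have defU : shadow_union e F = F0 :|: F1'.
  apply/setP=> z; apply/imsetP/setUP => [[x Fx ->]|[|/imsetP[x]]].
  - case ex: (e \in x); [right|left].
      by apply: imset_f; rewrite F1P Fx.
    have -> : x :\ e = x by apply/setDidPl; rewrite disjoint_sym disjoints1 ex.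
    by rewrite inE Fx ex.
  - rewrite inE => /andP[Fz ez]; exists z => //.
    by symmetry; apply/setDidPl; rewrite disjoint_sym disjoints1.
  - by rewrite F1P => /andP[Fx _] ->; exists x.
have defI : shadow_inter e F = F0 :&: F1'.
  apply/setP=> z; rewrite !inE -andbA; congr (_ && _).
  case ez: (e \in z) => //=; apply/idP/imsetP => [Fz|[x]].
    by exists (e |: z); rewrite ?setU1K ?ez // F1P Fz setU11.
  by rewrite F1P => /andP[Fx ex] ->; rewrite setD1K.
rewrite defU defI cardsUI card1 (cardsD F F0).
have /setIidPr -> : F0 \subset F by apply/subsetP => x; rewrite inE => /andP[].
by rewrite subnKC // subset_leq_card //; apply/subsetP => x; rewrite inE => /andP[].
Qed.

(** Chebyshev's sum inequality: the two sides differ by [(u - v) * (u' - v')]. *)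
Lemma leq_mul_cheb u v u' v' : (v <= u)%N -> (v' <= u')%N ->
  ((u + v) * (u' + v') <= 2 * (u * u' + v * v'))%N.
Proof. by move=> /subnKC <- /subnKC <-; nia. Qed.

Lemma shadow_inter_sub e F : (#|shadow_inter e F| <= #|shadow_union e F|)%N.
Proof.
apply/subset_leq_card/subsetP=> x; rewrite inE => /and3P[Fx ex _].
have -> : x = x :\ e.
  by symmetry; apply/setDidPl; rewrite disjoint_sym disjoints1.
exact: imset_f.
Qed.

(* Induction on an element [e] of [D]: sets in the two [shadow_inter] extend by
   [e], so their intersections have size less than [s]. *)
Lemma card_cross_intersecting s D F G :
    {in F, forall x, x \subset D} -> {in G, forall y, y \subset D} ->
    {in F & G, forall x y, #|x :&: y| <= s}%N ->
  (#|F| * #|G| <= binom_le #|D| s * 2 ^ #|D|)%N.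
Proof.
move: {-2}#|D| (erefl #|D|) => k.
elim: k => [|k IHk] in s D F G * => /esym cardD FD GD FGs.
  have le1 H : {in H, forall x, x \subset D} -> (#|H| <= 1)%N.
    move=> HD; rewrite -[leqRHS](cards1 (set0 : {set T})); apply: subset_leq_card.
    apply/subsetP=> x /HD; rewrite (cards0_eq cardD) subset0 => /eqP->.
    exact: set11.
  by rewrite binom_le0n (leq_mul (le1 _ FD) (le1 _ GD)).
have [e De] : exists e, e \in D by apply/set0Pn; rewrite -card_gt0 cardD.
have cardDe : #|D :\ e| = k by have := cardsD1 e D; rewrite De cardD => -[].
rewrite (card_shadows e F) (card_shadows e G).
apply: leq_trans (leq_mul_cheb (shadow_inter_sub _ _) (shadow_inter_sub _ _)) _.
have UD H : {in H, forall x, x \subset D} ->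
    {in shadow_union e H, forall x, x \subset D :\ e}.
  by move=> HD _ /imsetP[x /HD xD ->]; apply: setSD.
have ID H : {in H, forall x, x \subset D} ->
    {in shadow_inter e H, forall x, x \subset D :\ e}.
  by move=> HD x; rewrite inE subsetD1 => /and3P[/HD-> ->].
have leU : (#|shadow_union e F| * #|shadow_union e G|
            <= binom_le k s * 2 ^ k)%N.
  apply: (IHk _ (D :\ e)) => //; [exact: UD|exact: UD|].
  move=> _ _ /imsetP[x Fx ->] /imsetP[y Gy ->].
  apply: leq_trans (FGs x y Fx Gy); apply/subset_leq_card.
  by rewrite setISS ?subsetDl.
(* For [s = 0] no two sets can meet in fewer than 0 elements, so one of the two families is
   empty. *)
have leI : (#|shadow_inter e F| * #|shadow_inter e G|
            <= (if s is s'.+1 then binom_le k s' else 0) * 2 ^ k)%N.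
  have inI x y : x \in shadow_inter e F -> y \in shadow_inter e G ->
      (#|x :&: y| < s)%N.
    rewrite !inE => /and3P[_ ex Fx] /and3P[_ _ Gy].
    by have := FGs _ _ Fx Gy; rewrite -setUIr cardsU1 inE (negPf ex).
  case: s {FGs leU} inI => [|s'] inI; last first.
    by apply: (IHk _ (D :\ e)) => //; exact: ID.
  have [->|[x Fx]] := set_0Vmem (shadow_inter e F); first by rewrite cards0.
  have [->|[y Gy]] := set_0Vmem (shadow_inter e G); first by rewrite cards0 muln0.
  by have := inI x y Fx Gy.
rewrite expnS mulnCA leq_mul2l /=; apply: leq_trans (leq_add leU leI) _.
rewrite -mulnDl leq_mul2r; apply/orP; right.
by case: (s) => [|s']; rewrite ?binom_len0 ?addn0 // binom_leSS.
Qed.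

End Sgall.

(** * Covers of submatrices by rectangles *)

(* [B k] is the set of rectangles through row or column [k], so that
   [A i :&: B j] is the set of rectangles through the entry [(i, j)]. *)
Definition covers (d s n m : nat) (M : bmatrix n m)
    (A : 'I_n -> {set 'I_d}) (B : 'I_m -> {set 'I_d}) (X : pred 'I_n)
    (Y : pred 'I_m) :=
  forall i j, X i -> Y j ->
    M i j = (0 < #|A i :&: B j|)%N /\ (#|A i :&: B j| <= s)%N.

Definition coverable (d s n m : nat) (M : bmatrix n m) (X : seq 'I_n)
    (Y : seq 'I_m) :=
  exists A B, @covers d s n m M A B [in X] [in Y].

Section Covers.
Variables n m : nat.
Implicit Types (M : bmatrix n m).

Lemma has_s_coverP s d M :
  has_s_cover s d M <-> exists A B, @covers d s n m M A B xpredT xpredT.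
Proof.
split=> [[I [J [IJ1 IJc]]]|[A [B AB]]].
  exists (fun i => [set k | i \in I k]), (fun j => [set k | j \in J k]).
  move=> i j _ _; set c := _ :&: _.
  have cE : c = [set k | (i \in I k) && (j \in J k)] by apply/setP=> k; rewrite !inE.
  case Mij : (M i j); first by have /andP[] := IJc _ _ Mij; rewrite -cE => -> ->.
  have -> : c = set0; last by rewrite cards0.
  apply/setP=> k; rewrite cE !inE; apply/negP=> /andP[ik jk].
  by have := IJ1 _ _ _ ik jk; rewrite Mij.
exists (fun k => [set i | k \in A i]), (fun k => [set j | k \in B j]).
have cE i j : [set k | (i \in [set i | k \in A i]) && (j \in [set j | k \in B j])]
    = A i :&: B j by apply/setP=> k; rewrite !inE.
split=> [k i j|i j Mij] /=; last first.
  by rewrite cE; have [] := AB i j isT isT; rewrite Mij => <-.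
rewrite !inE => ik jk; have [-> _] := AB i j isT isT.
by apply/card_gt0P; exists k; rewrite inE ik.
Qed.

Lemma has_s_cover_widen s d d' M : (d' <= d)%N ->
  has_s_cover s d' M -> has_s_cover s d M.
Proof.
move=> le_d; rewrite !has_s_coverP => -[A [B AB]].
have inj : injective (widen_ord le_d).
  by move=> x y /(congr1 val) /= /val_inj.
exists (fun i => widen_ord le_d @: A i), (fun j => widen_ord le_d @: B j).
move=> i j _ _; rewrite -imsetI; last by move=> ? ? _ _; apply: inj.
by rewrite card_imset //; apply: AB.
Qed.

Lemma brs_leP s d M : brs_le s d M <-> has_s_cover s d M.
Proof.
split=> [[d' [le_d]]|]; first exact: has_s_cover_widen.
by move=> cov; exists d.
Qed.

Lemma brs_le_coverable s d M X Y : brs_le s d M -> coverable d s M X Y.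
Proof.
rewrite brs_leP has_s_coverP => -[A [B AB]].
by exists A, B => i j _ _; apply: AB.
Qed.

Lemma coverable_sub d s M X Y X' Y' : {subset X' <= X} -> {subset Y' <= Y} ->
  coverable d s M X Y -> coverable d s M X' Y'.
Proof.
move=> sX sY [A [B AB]]; exists A, B => i j /sX Xi /sY Yj; exact: AB.
Qed.

Lemma coverable_eq d s M M' X Y :
    {in X & Y, forall i j, M i j = M' i j} ->
  coverable d s M X Y -> coverable d s M' X Y.
Proof.
move=> eqM [A [B AB]]; exists A, B => i j Xi Yj.
by rewrite -eqM //; apply: AB.
Qed.

(** One rectangle per row. Hence rank exactly [d] forces [d <= n]. *)
Lemma has_s_cover_rows s M : (0 < s)%N -> has_s_cover s n M.
Proof.
move=> s_gt0; apply/has_s_coverP.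
exists (fun i => [set i]), (fun j => [set i | M i j]) => i j _ _.
have [Mij|nMij] := boolP (M i j).
  have /setIidPl -> : [set i] \subset [set i | M i j] by rewrite sub1set inE.
  by rewrite cards1.
rewrite (_ : _ :&: _ = set0) ?cards0 //; apply/setP=> k; rewrite !inE.
by apply/negP=> /andP[/eqP-> ]; apply/negP.
Qed.

Lemma has_s_cover_cols s M : (0 < s)%N -> has_s_cover s m M.
Proof.
move=> s_gt0; apply/has_s_coverP.
exists (fun i => [set j | M i j]), (fun j => [set j]) => i j _ _.
have [Mij|nMij] := boolP (M i j).
  have /setIidPr -> : [set j] \subset [set j | M i j] by rewrite sub1set inE.
  by rewrite cards1.
rewrite (_ : _ :&: _ = set0) ?cards0 //; apply/setP=> k; rewrite !inE.
by apply/negP=> /andP[+ /eqP-kj]; rewrite kj; apply/negP.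
Qed.

(** Dropping row [i0] from every rectangle keeps the counts in the other rows; the ones of the new
    row form one extra rectangle, with index [ord0]. *)
Lemma has_s_cover_change_row s d M M' i0 : (0 < s)%N ->
    (forall i j, i != i0 -> M' i j = M i j) ->
  has_s_cover s d M -> has_s_cover s d.+1 M'.
Proof.
move=> s_gt0 eqM; rewrite !has_s_coverP => -[A [B AB]].
pose up (C : {set 'I_d}) := lift ord0 @: C.
have up0 C : ord0 \notin up C.
  by apply/imsetP=> -[k _] /eqP; rewrite (negPf (neq_lift _ _)).
exists (fun i => if i == i0 then [set ord0] else up (A i)).
exists (fun j => (if M' i0 j then [set ord0] else set0) :|: up (B j)) => i j _ _.
have [->|ne_i] := eqVneq i i0.
  have -> : [set ord0] :&: ((if M' i0 j then [set ord0] else set0) :|: up (B j))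
      = (if M' i0 j then [set ord0] else set0).
    apply/setP=> k; rewrite !inE.
    have [->|] := eqVneq k ord0; rewrite /= ?(negPf (up0 _)) ?orbF //.
    by case: ifP; rewrite !inE // => _ /negPf.
  by case: ifP; rewrite ?cards1 ?cards0.
rewrite eqM // (_ : _ :&: _ = up (A i :&: B j)).
  by rewrite card_imset; [apply: AB | apply: lift_inj].
rewrite setIUr [up (_ :&: _)]imsetI; last by move=> ? ? _ _; apply: lift_inj.
rewrite (_ : _ :&: (if _ then _ else _) = set0) ?set0U //.
case: ifP; rewrite ?setI0 // => _; apply/setP=> k; rewrite !inE.
by apply/negP=> /andP[+ /eqP-k0]; rewrite k0 (negPf (up0 _)).
Qed.

(** The values of row [x] on [Y] depend only on [A x], so distinct rows have distinct sets, and
    likewise for columns; Sgall's bound applies to these two families. *)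
Lemma coverable_size s d M X Y A B : @covers d s n m M A B [in X] [in Y] ->
    uniq [seq [seq M x y | y <- Y] | x <- X] ->
    uniq [seq [seq M x y | x <- X] | y <- Y] ->
  [/\ (size X <= 2 ^ d)%N, (size Y <= 2 ^ d)%N
    & (size X * size Y <= binom_le d s * 2 ^ d)%N].
Proof.
move=> AB uX uY.
have uA : uniq (map A X).
  apply: (@map_uniq _ _ (fun a => [seq (0 < #|a :&: B y|)%N | y <- Y])).
  rewrite -map_comp; move: uX; congr (uniq _); apply/eq_in_map=> x Xx /=.
  by apply/eq_in_map=> y Yy; have [-> _] := AB x y Xx Yy.
have uB : uniq (map B Y).
  apply: (@map_uniq _ _ (fun b => [seq (0 < #|A x :&: b|)%N | x <- X])).
  rewrite -map_comp; move: uY; congr (uniq _); apply/eq_in_map=> y Yy /=.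
  by apply/eq_in_map=> x Xx; have [-> _] := AB x y Xx Yy.
pose F := [set a in map A X]; pose G := [set b in map B Y].
have cF : #|F| = size X by rewrite cardsE (card_uniqP uA) size_map.
have cG : #|G| = size Y by rewrite cardsE (card_uniqP uB) size_map.
have le2 (H : {set {set 'I_d}}) : (#|H| <= 2 ^ d)%N.
  have := subset_leq_card (subsetT H).
  by rewrite -powersetT card_powerset cardsT card_ord.
rewrite -cF -cG; split=> //.
have := @card_cross_intersecting _ s [set: 'I_d] F G.
rewrite cardsT card_ord; apply=> [a _|b _|a b]; rewrite ?subsetT //.
rewrite !inE => /mapP[x Xx ->] /mapP[y Yy ->].
by have [] := AB x y Xx Yy.
Qed.

End Covers.

(** * Averages over finite sequences *)

Section Average.
Variable F : realFieldType.

Definition avg (T : Type) (s : seq T) (f : T -> F) : F :=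
  (\sum_(x <- s) f x) / (size s)%:R.

Lemma avg_le (T : eqType) (s : seq T) (f g : T -> F) :
  {in s, forall x, f x <= g x} -> avg s f <= avg s g.
Proof.
by move=> fg; rewrite ler_wpM2r ?invr_ge0 ?ler0n // big_seq [leRHS]big_seq ler_sum.
Qed.

(** The bound is nonnegative because an empty average is [0 / 0 = 0]. *)
Lemma avg_const_le (T : eqType) (s : seq T) (f : T -> F) c : 0 <= c ->
  {in s, forall x, f x <= c} -> avg s f <= c.
Proof.
move=> c_ge0 fc; apply: le_trans (avg_le fc) _.
rewrite /avg big_const_seq count_predT iter_addr_0 -[c *+ _]mulr_natr.
have [->|s_neq0] := eqVneq (size s)%:R (0 : F); first by rewrite mulr0 mul0r.
by rewrite mulfK.
Qed.

Lemma avgD (T : Type) (s : seq T) (f g : T -> F) :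
  avg s (fun x => f x + g x) = avg s f + avg s g.
Proof. by rewrite /avg big_split mulrDl. Qed.

Lemma avgC (T U : Type) (s : seq T) (t : seq U) (f : T -> U -> F) :
  avg s (fun x => avg t (f x)) = avg t (fun y => avg s (f^~ y)).
Proof. by rewrite /avg -!mulr_suml exchange_big /= mulrAC. Qed.

Lemma avg_allpairs (T U V : Type) (h : T -> U -> V) (s : seq T) (t : seq U)
    (f : V -> F) :
  avg [seq h x y | x <- s, y <- t] f = avg s (fun x => avg t (fun y => f (h x y))).
Proof.
rewrite /avg size_allpairs natrM invfM -mulr_suml big_allpairs_dep.
by rewrite mulrAC mulrA.
Qed.

Lemma avg_hit (T : eqType) (s : seq T) (hit : pred T) (f : T -> F) q c :
    0 <= c -> {in s, forall x, f x <= 1} ->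
    {in s, forall x, hit x -> f x <= c} ->
    avg s (fun x => (~~ hit x)%:R) <= q ->
  avg s f <= q + c.
Proof.
move=> c_ge0 f_le1 f_lec missq.
apply: le_trans (_ : avg s (fun x => (~~ hit x)%:R + c) <= _).
  apply: avg_le => x sx; case: (boolP (hit x)) => [/f_lec|_]; rewrite ?add0r.
    exact.
  by rewrite (le_trans (f_le1 _ sx)) // lerDl.
by rewrite avgD lerD // avg_const_le.
Qed.

End Average.

Section Words.
Variable T : eqType.

(** Averaging over words of length [l] models [l] independent uniform draws from [E]; nesting
    [words] draws sequences of blocks. *)
Fixpoint words (E : seq T) (l : nat) : seq (seq T) :=
  if l is l'.+1 then [seq a :: w | a <- E, w <- words E l'] else [:: [::]].

Lemma size_words E l : size (words E l) = (size E ^ l)%N.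
Proof. by elim: l => //= l IHl; rewrite size_allpairs IHl expnS. Qed.

Lemma size_in_words E l w : w \in words E l -> size w = l.
Proof.
elim: l w => [|l IHl] w /=; first by rewrite inE => /eqP->.
by case/allpairsP=> -[a v] [_ /IHl <- ->].
Qed.

Lemma words_sub E l w : w \in words E l -> {subset w <= E}.
Proof.
elim: l w => [|l IHl] w /=; first by rewrite inE => /eqP->.
case/allpairsP=> -[a v] [/= Ea /IHl vE ->] x; rewrite inE.
by case/predU1P=> [->|/vE].
Qed.

Lemma count_words (P : pred T) E l : count (all P) (words E l) = (count P E ^ l)%N.
Proof.
elim: l => //= l; rewrite expnS => <-; move: (words E l) => W.
elim: E => //= a E IHE.
rewrite count_cat IHE count_map mulnDl; congr (_ + _)%N.
have [Pa|nPa] := boolP (P a); first by rewrite mul1n; apply: eq_count => w /=; rewrite Pa.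
by rewrite mul0n -(count_pred0 W); apply: eq_count => w /=; rewrite (negPf nPa).
Qed.

End Words.

(** Each of the [l] independent draws misses [G] with probability [1 - #|G| / #|T|]. The absolute
    value keeps the base nonnegative for every [delta]. *)
Lemma avg_words_miss (T : finType) (G : pred T) (l : nat) (delta : R) :
    delta * #|T|%:R <= #|G|%:R ->
  avg (words (enum T) l) (fun b => (~~ has G b)%:R) <= `|1 - delta| ^+ l.
Proof.
move=> G_large; rewrite /avg -natr_sum size_words.
have -> : (\sum_(b <- words (enum T) l) ~~ has G b = (#|T| - #|G|) ^ l)%N.
  have cG : count (predC G) (enum T) = (#|T| - #|G|)%N.
    by rewrite -(cardC G) addKn -size_filter cardE enumT.
  rewrite -cG -count_words -sum1_count [in RHS]big_mkcond /=.
  by apply: eq_bigr => b _; rewrite -all_predC; case: all.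
rewrite -cardE natrX natrX -expr_div_n lerXn2r ?nnegrE ?divr_ge0 ?ler0n //.
rewrite natrB ?max_card //.
have [T0|T_gt0] := posnP #|T|; first by rewrite T0 invr0 mulr0.
apply: le_trans (ler_norm _); rewrite mulrBl divff ?pnatr_eq0 -?lt0n //.
by rewrite lerD2l lerN2 ler_pdivlMr ?ltr0n.
Qed.

(** * Growing a submatrix *)

Section Representative.
Variables (T S : eqType) (f : T -> S) (s : seq T).

Definition representative (t : T) : T := nth t s (index (f t) (map f s)).

Lemma representativeP t : f t \in map f s ->
  representative t \in s /\ f (representative t) = f t.
Proof.
move=> fst; have lt_s : (index (f t) (map f s) < size s)%N.
  by rewrite -(size_map f) index_mem.
by rewrite mem_nth // -[RHS](nth_index (f t) fst) (nth_map t).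
Qed.

Lemma uniq_map_inj : uniq (map f s) -> {in s &, injective f}.
Proof.
elim: s => //= a r IHr /andP[nfa ur] x y; rewrite !inE.
move=> /orP[/eqP->|xr] /orP[/eqP->|yr] // eq_f.
- by rewrite eq_f map_f in nfa.
- by rewrite -eq_f map_f in nfa.
- exact: IHr.
Qed.

End Representative.

Section Growth.
Variables (n m : nat) (M : bmatrix n m) (d s l : nat) (q delta : R).
Implicit Types (X : seq 'I_n) (Y : seq 'I_m).

Local Notation width := (4 * (binom_le d s * 2 ^ d))%N.

Definition row_sig Y i : seq bool := [seq M i j | j <- Y].
Definition col_sig X j : seq bool := [seq M i j | i <- X].
Definition distinct_sigs X Y : Prop :=
  uniq (map (row_sig Y) X) /\ uniq (map (col_sig X) Y).

(* The test accepts from the state [(X, Y)] when it will see the fresh blocks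
   of rows [rho] and of columns [kappa]. *)
Definition passes X Y (rho : seq (seq 'I_n)) (kappa : seq (seq 'I_m)) : Prop :=
  forall a b, ((size X + a) * (size Y + b) <= width)%N ->
    coverable d s M (X ++ flatten (take a rho)) (Y ++ flatten (take b kappa)).

Definition pass_prob X Y lr lc : R :=
  avg (words (words (enum 'I_n) l) lr) (fun rho =>
    avg (words (words (enum 'I_m) l) lc) (fun kappa =>
      (`[< passes X Y rho kappa >])%:R)).

Hypothesis miss_le : `|1 - delta| ^+ l <= q.

(** As [x] lies in the block [b], the new state with [a] further blocks uses only rows of the old
    state with [a.+1] blocks, and the total [size X + a] is the same in both. *)
Lemma passes_row X Y x b rho kappa : x \in b ->
  passes X Y (b :: rho) kappa -> passes (x :: X) Y rho kappa.
Proof.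
move=> bx pass a c le_w; apply: coverable_sub (pass a.+1 c _); last first.
- by rewrite addnS -addSn.
- by [].
move=> i; rewrite /= !mem_cat inE mem_cat => /or3P[/eqP->|->|->] //.
  by rewrite bx orbT.
by rewrite !orbT.
Qed.

Lemma passes_col X Y y b rho kappa : y \in b ->
  passes X Y rho (b :: kappa) -> passes X (y :: Y) rho kappa.
Proof.
move=> by_ pass a c le_w; apply: coverable_sub (pass a c.+1 _); last first.
- by rewrite addnS -addSn.
- move=> i; rewrite /= !mem_cat inE mem_cat => /or3P[/eqP->|->|->] //.
    by rewrite by_ orbT.
  by rewrite !orbT.
- by [].
Qed.

Lemma natb_le1 (b : bool) : b%:R <= 1 :> R.
Proof. by rewrite lern1 leq_b1. Qed.

(** Condition on the first row block: it misses [G] with probability at most [q]; otherwise one of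
    its rows in [G] is added, and the remaining blocks are still fresh. *)
Lemma pass_prob_row X Y lr lc (G : pred 'I_n) c : 0 <= c ->
    delta * n%:R <= #|G|%:R ->
    (forall x, G x -> pass_prob (x :: X) Y lr lc <= c) ->
  pass_prob X Y lr.+1 lc <= q + c.
Proof.
move=> c_ge0 G_large stepG; rewrite /pass_prob /= avg_allpairs.
apply: (avg_hit (hit := has G)) => //.
- move=> b _; apply: avg_const_le => // rho _.
  by apply: avg_const_le => // kappa _; apply: natb_le1.
- move=> b _ /hasP[x bx Gx]; apply: le_trans (stepG x Gx).
  apply: avg_le => rho _; apply: avg_le => kappa _; rewrite ler_nat.
  case: asboolP => // pass; rewrite lt0b; apply/asboolP.
  exact: passes_row bx pass.
- by apply: le_trans miss_le; apply: avg_words_miss; rewrite card_ord.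
Qed.

Lemma pass_prob_col X Y lr lc (G : pred 'I_m) c : 0 <= c ->
    delta * m%:R <= #|G|%:R ->
    (forall y, G y -> pass_prob X (y :: Y) lr lc <= c) ->
  pass_prob X Y lr lc.+1 <= q + c.
Proof.
move=> c_ge0 G_large stepG; rewrite /pass_prob avgC /= avg_allpairs.
apply: (avg_hit (hit := has G)) => //.
- move=> b _; apply: avg_const_le => // rho _.
  by apply: avg_const_le => // kappa _; apply: natb_le1.
- move=> b _ /hasP[y by_ Gy]; apply: le_trans (stepG y Gy).
  rewrite /pass_prob avgC.
  apply: avg_le => rho _; apply: avg_le => kappa _; rewrite ler_nat.
  case: asboolP => // pass; rewrite lt0b; apply/asboolP.
  exact: passes_col by_ pass.
- by apply: le_trans miss_le; apply: avg_words_miss; rewrite card_ord.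
Qed.

Lemma uniq_row_sig_cons X Y j :
  uniq (map (row_sig Y) X) -> uniq (map (row_sig (j :: Y)) X).
Proof.
move=> uX; apply: (@map_uniq _ _ behead).
by rewrite -map_comp.
Qed.

Lemma uniq_col_sig_cons X Y i :
  uniq (map (col_sig X) Y) -> uniq (map (col_sig (i :: X)) Y).
Proof.
move=> uY; apply: (@map_uniq _ _ behead).
by rewrite -map_comp.
Qed.

Lemma distinct_sigs_row X Y i : distinct_sigs X Y ->
  row_sig Y i \notin map (row_sig Y) X -> distinct_sigs (i :: X) Y.
Proof.
by move=> [uX uY] new; split; [rewrite /= new | apply: uniq_col_sig_cons].
Qed.

Lemma distinct_sigs_col X Y j : distinct_sigs X Y ->
  col_sig X j \notin map (col_sig X) Y -> distinct_sigs X (j :: Y).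
Proof.
by move=> [uX uY] new; split; [apply: uniq_row_sig_cons | rewrite /= new].
Qed.

(** Rows and columns with an unseen signature become zero and need no rectangle; all others inherit
    the rectangles of their representatives. *)
Definition extrapolation X Y : bmatrix n m := fun i j =>
  [&& row_sig Y i \in map (row_sig Y) X, col_sig X j \in map (col_sig X) Y
    & M (representative (row_sig Y) X i) (representative (col_sig X) Y j)].

Lemma extrapolation_brs_le X Y :
  coverable d s M X Y -> brs_le s d (extrapolation X Y).
Proof.
move=> [A [B AB]]; apply/brs_leP/has_s_coverP.
exists (fun i => if row_sig Y i \in map (row_sig Y) X
           then A (representative (row_sig Y) X i) else set0).
exists (fun j => if col_sig X j \in map (col_sig X) Y
           then B (representative (col_sig X) Y j) else set0) => i j _ _.
rewrite /extrapolation; case: ifP => [/representativeP[Xi _]|_]; last first.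
  by rewrite set0I cards0.
case: ifP => [/representativeP[Yj _]|_]; last by rewrite setI0 cards0.
exact: AB.
Qed.

(** Among the rows of [X], only the representative [x0] of [i] agrees with [i] on [Y], and
    [M x0 j = M x0 y0] is the extrapolated value, which differs from [M i j]. Columns are
    symmetric. *)
Lemma distinct_sigs_both X Y i j : distinct_sigs X Y ->
    row_sig Y i \in map (row_sig Y) X -> col_sig X j \in map (col_sig X) Y ->
    M i j != extrapolation X Y i j ->
  distinct_sigs (i :: X) (j :: Y).
Proof.
move=> [uX uY] oldi oldj; rewrite /extrapolation oldi oldj /=.
have [] := representativeP oldi; move: (representative _ _ i) => x0 Xx0 eq_x0.
have [] := representativeP oldj; move: (representative _ _ j) => y0 Yy0 eq_y0.
move=> neqM.
have eqx y : y \in Y -> M x0 y = M i y by move: y; apply/eq_in_map.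
have eqy x : x \in X -> M x y0 = M x j by move: x; apply/eq_in_map.
split.
  rewrite map_cons cons_uniq uniq_row_sig_cons // andbT.
  apply/mapP=> -[x Xx [eqMj eqM]]; case/eqP: neqM.
  rewrite eqy // eqMj; congr (M _ j); apply: (uniq_map_inj uX) => //.
  by rewrite eq_x0.
rewrite map_cons cons_uniq uniq_col_sig_cons // andbT.
apply/mapP=> -[y Yy [eqMi eqM]]; case/eqP: neqM.
rewrite eqx // eqMi; congr (M i _); apply: (uniq_map_inj uY) => //.
by rewrite eq_y0.
Qed.

Lemma hamming_rows (M' : bmatrix n m) :
  hamming M M' = (\sum_i #|[pred j | M i j != M' i j]|)%N.
Proof.
rewrite /hamming -sum1_card (eq_bigl (fun p => true && (M p.1 p.2 != M' p.1 p.2))).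
  rewrite -(pair_big_dep xpredT (fun i j => M i j != M' i j) (fun _ _ => 1%N)) /=.
  by apply: eq_bigr => i _; rewrite -sum1_card.
by move=> p; rewrite inE.
Qed.

(** Otherwise [M] is close to its extrapolation: per row, new columns cost less than [delta * m] and
    so do the other mismatches of a light row, while the fewer than [delta * n] heavy rows cost at
    most [m] more. The total is at most [3 * delta * n * m]. *)
Lemma many_heavy_rows X Y : 0 <= delta -> coverable d s M X Y ->
    far (@brs_le n m s d) (4 * delta)%R M ->
    #|[pred j | col_sig X j \notin map (col_sig X) Y]|%:R < delta * m%:R ->
  delta * n%:R <= #|[pred i | delta * m%:R <= #|[pred j |
     (col_sig X j \in map (col_sig X) Y) && (M i j != extrapolation X Y i j)]|%:R
     ]|%:R.
Proof.
set NC := [pred j | _]; move=> delta_ge0 cov /(_ _ (extrapolation_brs_le cov)).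
set M' := extrapolation X Y; set H := [pred i | _] => farM few_new.
rewrite leNgt; apply/negP=> few_heavy; move: farM; apply/negP; rewrite -leNgt.
pose bad i := [pred j | (col_sig X j \in map (col_sig X) Y) && (M i j != M' i j)].
have row_le i : (#|[pred j | M i j != M' i j]|%:R
                 <= 2 * delta * m%:R + (H i)%:R * m%:R :> R).
  have le1 : (#|[pred j | M i j != M' i j]| <= #|NC| + #|bad i|)%N.
    rewrite -cardUI; apply: leq_trans (leq_addr _ _); apply: subset_leq_card.
    by apply/subsetP=> j; rewrite !inE => ->; rewrite andbT orNb.
  have {le1} := le1; rewrite -(ler_nat R) natrD => /le_trans; apply.
  case: (boolP (H i)) => [_|]; last first.
    rewrite inE -ltNge -/(bad i) mul0r => ltm; lra.
  have : #|bad i|%:R <= m%:R :> R by rewrite ler_nat (leq_trans (max_card _)) ?card_ord.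
  have : 0 <= delta * m%:R by rewrite mulr_ge0 ?ler0n.
  by rewrite mul1r; lra.
rewrite hamming_rows natr_sum.
apply: (@le_trans _ _ (\sum_i (2 * delta * m%:R + (H i)%:R * m%:R))).
  by apply: ler_sum => i _; apply: row_le.
rewrite big_split /= sumr_const card_ord -mulr_suml -natr_sum.
have -> : (\sum_i H i = #|H|)%N.
  rewrite -sum1_card [in RHS]big_mkcond; apply: eq_bigr => i _.
  by rewrite -[i \in H]/(H i); case: (H i).
have Hm : #|H|%:R * m%:R <= delta * n%:R * m%:R :> R.
  by rewrite ler_wpM2r ?ler0n // ltW.
have nm : 0 <= delta * n%:R * m%:R by rewrite !mulr_ge0 ?ler0n.
rewrite natrM -[X in X + _ <= _]mulr_natr.
move: Hm nm; move: (#|H|%:R : R) (n%:R : R) (m%:R : R) => h a b Hm nm.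
lra.
Qed.

Lemma binom_le_gt0 : (0 < binom_le d s)%N.
Proof. by rewrite /binom_le big_ord_recl bin0. Qed.

(** [k] bounds the rows and columns still to be added, each at the price of a failure probability
    [q]. A coverable state has both sides at most [2 ^ d], hence [k >= 2], enough to add a row and a
    column at once; an uncoverable state never passes. *)
Lemma pass_prob_le k X Y lr lc : 0 <= delta ->
    far (@brs_le n m s d) (4 * delta)%R M -> distinct_sigs X Y ->
    (size X * size Y <= width)%N ->
    (width <= size X + lr)%N -> (width <= size Y + lc)%N ->
    ((2 ^ d).*2.+2 <= k + size X + size Y)%N ->
  pass_prob X Y lr lc <= k%:R * q.
Proof.
move=> delta_ge0 farM.
have q_ge0 : 0 <= q by apply: le_trans miss_le; rewrite exprn_ge0.
elim/ltn_ind: k X Y lr lc => k IHk X Y lr lc sigXY leXY ler lec lek.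
have [cov|ncov] := pselect (coverable d s M X Y); last first.
  apply: le_trans (_ : 0 <= _); last by rewrite mulr_ge0 ?ler0n.
  apply: avg_const_le => // rho _; apply: avg_const_le => // kappa _.
  rewrite asboolF // => /(_ 0%N 0%N); rewrite !addn0 !take0 !cats0.
  by move/(_ leXY).
have [A [B AB]] := cov; have [uX uY] := sigXY.
have [sX sY sXY] : [/\ (size X <= 2 ^ d)%N, (size Y <= 2 ^ d)%N
  & (size X * size Y <= binom_le d s * 2 ^ d)%N] := coverable_size AB uX uY.
have pB : (2 ^ d <= binom_le d s * 2 ^ d)%N by rewrite leq_pmull ?binom_le_gt0.
have p0 : (0 < 2 ^ d)%N by rewrite expn_gt0.
move: (2 ^ d)%N pB p0 sX sY sXY leXY ler lec lek IHk => p.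
move: (binom_le d s * p)%N => b pB p0 sX sY sXY leXY ler lec lek IHk.
(* The factor 4 of [width] comes from here: one more row and column add at most [2 ^ d + 2 ^ d + 1]
   to an area of at most [b], and [2 ^ d <= b]. *)
have grow x y : (x <= (size X).+1)%N -> (y <= (size Y).+1)%N -> (x * y <= 4 * b)%N.
  move=> lex ley; apply: leq_trans (leq_mul lex ley) _; rewrite mulSn mulnS.
  by move: (size X * size Y)%N sXY; clear -sX sY pB p0 => xy; lia.
clear sXY leXY; case: k lek IHk => [|[|k]] lek IHk; [exfalso; lia|exfalso; lia|].
case: lr ler => [|lr] ler; first by exfalso; lia.
case: lc lec => [|lc] lec; first by exfalso; lia.
rewrite ?(addSn, addnS) in ler lec lek.
have kq_ge0 j : 0 <= j%:R * q by rewrite mulr_ge0 ?ler0n.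
have kqS j : j.+1%:R * q = q + j%:R * q by rewrite -addn1 natrD; ring.
rewrite kqS; pose NC := [pred j | col_sig X j \notin map (col_sig X) Y].
have [manyNC|fewNC] := leP (delta * m%:R) #|NC|%:R.
  apply: (pass_prob_col (G := NC)) => // y newy.
  by apply: IHk => /=; rewrite ?(addSn, addnS) //; [exact: distinct_sigs_col|exact: grow].
(* A heavy row with a new signature is added alone. With an old one, at least [delta * m] old
   columns contradict the extrapolation; hitting one lets both be added, at cost [2 * q]. *)
apply: (pass_prob_row (kq_ge0 _) (many_heavy_rows delta_ge0 cov farM fewNC)) => x.
rewrite inE => heavyx; have [oldx|newx] := boolP (row_sig Y x \in map (row_sig Y) X).
  rewrite kqS; apply: (pass_prob_col _ heavyx) => // y; rewrite inE => /andP[oldy bad].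
  by apply: IHk => /=; rewrite ?(addSn, addnS) //; [exact: distinct_sigs_both|exact: grow].
by apply: IHk => /=; rewrite ?(addSn, addnS) //; [exact: distinct_sigs_row|exact: grow].
Qed.

End Growth.

(** * Consistency testers *)

Section Tester.
Variables (n m : nat) (qs : seq (seq ('I_n * 'I_m))).
Implicit Types (P : bmatrix n m -> Prop) (M : bmatrix n m).

(* Picks one of the query lists uniformly, and accepts when the answers are
   those of some matrix with the property. *)
Definition consistency_tester P : tester n m :=
  @Tester n m (size qs) (fun=> (size qs)%:R^-1) (fun k => nth [::] qs k)
    (fun k ans => `[< exists2 M', P M' & answers M' (nth [::] qs k) = ans >]).

Lemma accept_prob_consistency P M : accept_prob (consistency_tester P) M =
  avg qs (fun q => (`[< exists2 M', P M' & answers M' q = answers M q >])%:R).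
Proof.
rewrite /accept_prob /avg (big_nth [::]) big_mkord mulr_suml big_mkcond /=.
by apply: eq_bigr => k _; case: asboolP; rewrite ?mul1r ?mul0r.
Qed.

Lemma consistency_tester_valid P : qs != [::] -> tester_valid (consistency_tester P).
Proof.
move=> qs_neq0; split=> [k|] /=; first by rewrite invr_ge0 ler0n.
by rewrite sumr_const card_ord -[LHS]mulr_natr mulVf // pnatr_eq0 size_eq0.
Qed.

Lemma consistency_tester_complete P M : qs != [::] -> P M ->
  accept_prob (consistency_tester P) M = 1.
Proof.
move=> qs_neq0 PM; have [_ <-] := consistency_tester_valid P qs_neq0.
by apply: eq_bigl => k /=; apply/asboolP; exists M.
Qed.

Lemma accept_prob_sub P P' M : (forall M', P M' -> P' M') ->
  accept_prob (consistency_tester P) M <= accept_prob (consistency_tester P') M.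
Proof.
move=> PP'; rewrite !accept_prob_consistency; apply: avg_le => q _.
rewrite ler_nat; case: asboolP => // -[M' PM' eqM]; rewrite lt0b; apply/asboolP.
by exists M' => //; apply: PP'.
Qed.

End Tester.

(** Agreement on all entries means distance 0 from the property. This serves matrices too small for
    sampling. *)
Lemma full_query_tester n m (P : bmatrix n m -> Prop) eps : 0 <= eps ->
  one_sided_tester P eps
    (consistency_tester [:: enum {: 'I_n * 'I_m}] P).
Proof.
move=> eps_ge0; split; first exact: consistency_tester_valid.
split=> [M PM|M farM]; first exact: consistency_tester_complete.
rewrite accept_prob_consistency /avg big_seq1 asboolF ?mul0r ?divr_ge0 ?ler0n //.
move=> [M' PM' /eq_in_map eqM]; have := farM _ PM'.
rewrite (_ : hamming M M' = 0%N).
  by rewrite ltNge mulr_ge0 ?ler0n.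
apply/eqP; rewrite cards_eq0; apply/eqP/setP=> p.
by rewrite !inE eqM ?mem_enum ?eqxx.
Qed.

(** * Queries under a hyperbola *)

Section Hyperbola.
Variables (T U : eqType) (w : nat) (rho : seq (seq T)) (kappa : seq (seq U)).

(** Blocks are numbered from 0: row block [a] ends a prefix of [a.+1] blocks, hence the divisor. *)
Definition hyperbola : seq (T * U) :=
  flatten [seq [seq (i, j) | i <- nth [::] rho a,
                             j <- flatten (take (w %/ a.+1) kappa)] | a <- iota 0 w].

Lemma mem_hyperbola a b i j : (a * b <= w)%N -> (size rho <= w)%N ->
    i \in flatten (take a rho) -> j \in flatten (take b kappa) ->
  (i, j) \in hyperbola.
Proof.
move=> le_w size_rho /flattenP[r]; case/(nthP [::])=> a'; rewrite size_take_min.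
rewrite leq_min => /andP[lt_a lt_rho]; rewrite nth_take // => <- ri.
move=> /flattenP[c cb cj]; apply/flattenP.
exists [seq (i, j) | i <- nth [::] rho a', j <- flatten (take (w %/ a'.+1) kappa)].
  by apply: map_f; rewrite mem_iota (leq_trans lt_rho).
apply/allpairsP; exists (i, j); split=> //=; apply/flattenP; exists c => //.
have le_b : (b <= w %/ a'.+1)%N.
  by rewrite leq_divRL // mulnC (leq_trans _ le_w) // leq_mul2r lt_a orbT.
by rewrite -(subnKC le_b) takeD mem_cat cb.
Qed.

Lemma size_hyperbola l :
    {in rho, forall r, size r = l} -> {in kappa, forall c, size c = l} ->
  (size hyperbola <= l ^ 2 * \sum_(a < w) w %/ a.+1)%N.
Proof.
move=> size_r size_c; rewrite size_flatten /shape -map_comp sumnE big_map.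
rewrite (_ : iota 0 w = index_iota 0 w) ?big_mkord; last by rewrite /index_iota subn0.
rewrite big_distrr /=.
apply: leq_sum => a _; rewrite size_allpairs expnS expn1 -mulnA leq_mul //.
  have [lt_a|ge_a] := ltnP a (size rho); first by rewrite size_r // mem_nth.
  by rewrite nth_default.
rewrite size_flatten /shape.
have: {in take (w %/ a.+1) kappa, forall c, size c = l}.
  by move=> c /mem_take /size_c.
have: (size (take (w %/ a.+1) kappa) <= w %/ a.+1)%N by rewrite size_take_min geq_minl.
move: (w %/ a.+1)%N => v; move: (take v kappa) => t le_v size_t.
apply: leq_trans (_ : l * size t <= _)%N; last by rewrite leq_mul2l le_v orbT.
elim: t {le_v} size_t => //= c t IHt size_t.
rewrite mulnS leq_add // ?size_t ?mem_head // IHt // => x tx.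
by rewrite size_t // inE tx orbT.
Qed.

End Hyperbola.

(** * Logarithmic bound on the number of block pairs *)

Lemma ln_monotone x y : Rlt 0 x -> Rle x y -> Rle (ln x) (ln y).
Proof.
move=> x_gt0 [lt_xy|->]; last exact: Rle_refl.
by apply/Rlt_le/ln_increasing.
Qed.

Lemma ln_natr_ge0 k : (0 < k)%N -> 0 <= ln k%:R :> R.
Proof.
move=> k_gt0; suff : Rle (ln 1) (ln k%:R) by rewrite ln_1 => /RleP.
by apply: ln_monotone; [exact: Rlt_0_1 | apply/RleP; rewrite ler1n].
Qed.

Lemma harmonic_le_ln w : (0 < w)%N ->
  \sum_(a < w) (a.+1%:R)^-1 <= 1 + ln w%:R :> R.
Proof.
elim: w => // -[_ _|w IHw _]; first by rewrite big_ord1 invr1 ln_1 addr0.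
rewrite big_ord_recr /=; apply: le_trans (lerD (IHw isT) (lexx _)) _.
rewrite -addrA lerD2l.
have w1 : 0 < w.+1%:R :> R by rewrite ltr0n.
have w2 : 0 < w.+2%:R :> R by rewrite ltr0n.
have -> : w.+1%:R = w.+2%:R * (1 - w.+2%:R^-1) :> R.
  by rewrite mulrBr mulr1 divff ?gt_eqF // -[w.+2]addn1 natrD addrK.
have r0 : 0 < 1 - w.+2%:R^-1 :> R by rewrite subr_gt0 invf_lt1 // ltr1n.
have -> : ln (w.+2%:R * (1 - w.+2%:R^-1)) = ln w.+2%:R + ln (1 - w.+2%:R^-1).
  by apply: ln_mult; apply/RltP.
have : ln (1 - w.+2%:R^-1) <= - w.+2%:R^-1.
  rewrite -[leRHS]ln_exp; apply/RleP; apply: ln_monotone; last first.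
    by apply/RleP; have /RleP := exp_ineq1_le (- w.+2%:R^-1).
  exact/RltP.
by move=> lnw; rewrite -addrA gerDl -lerBrDr sub0r.
Qed.

Lemma sum_divn_le_ln w : (0 < w)%N ->
  (\sum_(a < w) w %/ a.+1)%:R <= w%:R * (1 + ln w%:R) :> R.
Proof.
move=> w_gt0; rewrite natr_sum; apply: (@le_trans _ _ (\sum_(a < w) (w%:R / a.+1%:R))).
  apply: ler_sum => a _; rewrite ler_pdivlMr ?ltr0n // -natrM ler_nat.
  exact: leq_divM.
by rewrite -mulr_sumr ler_wpM2l ?ler0n // harmonic_le_ln.
Qed.

(** * Sampling and rank exactly d *)

Lemma hamming_triangle n m (M1 M2 M3 : bmatrix n m) :
  (hamming M1 M3 <= hamming M1 M2 + hamming M2 M3)%N.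
Proof.
rewrite /hamming -cardsUI; apply: leq_trans (leq_addr _ _).
apply/subset_leq_card/subsetP=> p; rewrite !inE.
by case: (M1 _ _); case: (M2 _ _); case: (M3 _ _).
Qed.

Section Exact.
Variables (n m s d : nat).
Hypotheses (s_gt0 : (0 < s)%N) (d_gt0 : (0 < d)%N).
Hypotheses (le_dn : (d <= n)%N) (le_dm : (d <= m)%N).
Variable M : bmatrix n m.

Definition plant_identity (t : nat) : bmatrix n m := fun i j =>
  if (i < t)%N && (j < d)%N then i == j :> nat else M i j.

(** A rectangle through the diagonal entries [i] and [j] contains [(i, j)], which is zero unless
    [i = j]; so the [d] diagonal ones need different rectangles. *)
Lemma plant_identity_rank d' : (d' < d)%N ->
  ~ has_s_cover s d' (plant_identity d).
Proof.
move=> lt_d /has_s_coverP[A [B AB]].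
pose u := widen_ord le_dn; pose v := widen_ord le_dm.
have plantE (i j : 'I_d) : plant_identity d (u i) (v j) = (i == j).
  by rewrite /plant_identity /= !ltn_ord.
have /fin_all_exists[f fP] (i : 'I_d) : exists k, k \in A (u i) :&: B (v i).
  by apply/card_gt0P; have [<- _] := AB (u i) (v i) isT isT; rewrite plantE.
suff /leq_card : injective f by rewrite !card_ord leqNgt lt_d.
move=> i j eq_f; apply/eqP; rewrite -plantE.
have [-> _] := AB (u i) (v j) isT isT; apply/card_gt0P; exists (f i).
have := fP i; have := fP j; rewrite -eq_f !inE.
by move=> /andP[_ ->] /andP[-> _].
Qed.

Lemma plant_identity_row t : (t < n)%N -> has_s_cover s d.-1 (plant_identity t) ->
  has_s_cover s d (plant_identity t.+1).
Proof.
move=> lt_t; rewrite -{2}(prednK d_gt0).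
apply: (has_s_cover_change_row (i0 := Ordinal lt_t)) => // i j ne_i.
by rewrite /plant_identity ltnS leq_eqVlt (_ : i == t :> nat = false) //; apply: negPf.
Qed.

Lemma hamming_plant_identity t : (t <= d)%N ->
  (hamming M (plant_identity t) <= d ^ 2)%N.
Proof.
move=> le_t.
pose sq := [set (widen_ord le_dn p.1, widen_ord le_dm p.2) | p in [set: 'I_d * 'I_d]].
apply: (@leq_trans #|sq|); last first.
  by apply: leq_trans (leq_imset_card _ _) _; rewrite cardsT card_prod card_ord.
apply/subset_leq_card/subsetP=> -[i j]; rewrite inE /plant_identity /=.
case: ifP => [/andP[lt_i lt_j] _|]; last by rewrite eqxx.
apply/imsetP; exists (Ordinal (leq_trans lt_i le_t), Ordinal lt_j) => //.
by congr (_, _); apply: val_inj.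
Qed.

(* Planting the identity row by row raises the rank by at most one at each
   step and ends with a rank at least [d], so it passes through [d]. *)
Lemma brs_eq_nearby : brs_le s d M ->
  exists2 M', brs_eq s d M' & (hamming M M' <= d ^ 2)%N.
Proof.
move=> /brs_leP covM.
pose high t := ~~ `[< has_s_cover s d.-1 (plant_identity t) >].
have high_d : high d by apply/asboolPn; apply: plant_identity_rank; rewrite prednK.
case: (ex_minnP (ex_intro high d high_d)) => t /asboolPn high_t min_t.
have le_t : (t <= d)%N by apply: min_t.
exists (plant_identity t); last exact: hamming_plant_identity.
split=> [|d' lt_d' cov]; last first.
  by apply: high_t; apply: has_s_cover_widen cov; rewrite -ltnS prednK.
(* For [t = 0] nothing is planted and [covM] applies. Otherwise minimality gives the preceding
   matrix a cover of size [d.-1]. *)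
case: t min_t le_t {high_t} => [//|t] min_t le_t.
apply: plant_identity_row; first exact: leq_trans le_t le_dn.
by apply: contrapT => /asboolPn /min_t; rewrite ltnn.
Qed.

End Exact.

(** Planting moves a matrix of rank at most [d] by at most [d ^ 2], half of the allowed distance.
    The existence of [M0] ensures that the identity fits. *)
Lemma far_brs_eq_brs_le n m s d eps (M M0 : bmatrix n m) :
    (0 < s)%N -> (0 < d)%N -> 2 * (d ^ 2)%:R <= eps * (n * m)%:R ->
    brs_eq s d M0 ->
  far (@brs_eq n m s d) eps M -> far (@brs_le n m s d) (eps / 2)%R M.
Proof.
move=> s_gt0 d_gt0 large [_ minM0] farM M' leM'.
have le_dn : (d <= n)%N.
  by rewrite leqNgt; apply/negP=> /minM0; apply; apply: has_s_cover_rows.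
have le_dm : (d <= m)%N.
  by rewrite leqNgt; apply/negP=> /minM0; apply; apply: has_s_cover_cols.
have [M'' eqM'' near] := brs_eq_nearby s_gt0 d_gt0 le_dn le_dm leM'.
have := farM _ eqM''; have := hamming_triangle M M' M''.
move: near; rewrite -!(ler_nat R) natrD => near tri farM''.
rewrite mulrAC; lra.
Qed.

(** * The sampling tester *)

Section Sampling.
Variables (eps : R) (d s n m : nat).

Local Notation width := (4 * (binom_le d s * 2 ^ d))%N.

(** The first factor brings the chance of missing a set of density [eps / 4] down to [1 / 2]; the
    factor [d + 4] beats the [2 * 2 ^ d + 2] growth steps. *)
Definition block_length : nat := ((Num.truncn (4 / eps)).+1 * (d + 4))%N.

Definition sample_queries : seq (seq ('I_n * 'I_m)) :=
  [seq hyperbola width rho kappa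
    | rho <- words (words (enum 'I_n) block_length) width,
      kappa <- words (words (enum 'I_m) block_length) width].

Lemma bernoulli (x : R) k : 0 <= x -> 1 + k%:R * x <= (1 + x) ^+ k.
Proof.
move=> x_ge0; elim: k => [|k IHk]; first by rewrite mul0r addr0 expr0.
have x1 : 0 <= 1 + x by rewrite addr_ge0.
rewrite exprS; apply: le_trans (ler_wpM2l x1 IHk).
have : 0 <= k%:R * x ^+ 2 by rewrite mulr_ge0 ?ler0n ?sqr_ge0.
by rewrite -[k.+1]addn1 natrD; lra.
Qed.

Hypothesis eps01 : 0 < eps < 1.

(** With [x = eps / 4] and [k > 1 / x], the powers [(1 - x) ^ k] and [(1 + x) ^ k] have product at
    most 1, and the second is at least 2 by Bernoulli's inequality. *)
Lemma block_miss_le : `|1 - eps / 4| ^+ block_length <= 2^-1 ^+ (d + 4).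
Proof.
have /andP[eps0 eps1] := eps01; rewrite ger0_norm; last by lra.
rewrite /block_length exprM.
have: 4 / eps < (Num.truncn (4 / eps)).+1%:R by apply: truncnS_gt.
move: (Num.truncn _).+1 => k k_gt.
have ge0 : 0 <= (1 - eps / 4) ^+ k by rewrite exprn_ge0 //; lra.
rewrite lerXn2r ?nnegrE // ?invr_ge0 //.
have k_eps : 1 <= k%:R * (eps / 4).
  by move: k_gt; rewrite ltr_pdivrMr // => k_gt; lra.
have two_le : 2 <= (1 + eps / 4) ^+ k.
  by apply: le_trans (bernoulli k _); lra.
have prod_le : (1 - eps / 4) ^+ k * (1 + eps / 4) ^+ k <= 1.
  by rewrite -exprMn exprn_ile1 //; nra.
rewrite -[2^-1]mul1r ler_pdivlMr //; apply: le_trans prod_le.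
exact: ler_wpM2l.
Qed.

Lemma sample_queries_neq0 : (0 < n)%N -> (0 < m)%N -> sample_queries != [::].
Proof.
move=> n_gt0 m_gt0; rewrite -size_eq0 -lt0n size_allpairs !size_words -!cardE.
by rewrite !card_ord muln_gt0 !expn_gt0 n_gt0 m_gt0.
Qed.

(** A consistent matrix of rank at most [d] yields a cover of every fully queried submatrix, so
    acceptance implies [passes] from the empty state. *)
Lemma sample_tester_sound (M : bmatrix n m) : far (@brs_le n m s d) eps M ->
  accept_prob (consistency_tester sample_queries (@brs_le n m s d)) M <= 1 / 3.
Proof.
have /andP[eps0 eps1] := eps01; move=> farM.
rewrite accept_prob_consistency avg_allpairs.
apply: (@le_trans _ _ (pass_prob M d s block_length [::] [::] width width)).
  apply: avg_le => rho in_rho; apply: avg_le => kappa _; rewrite ler_nat.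
  case: asboolP => // -[M' leM' /eq_in_map eqM]; rewrite lt0b; apply/asboolP.
  move=> a b le_w; apply: coverable_eq (brs_le_coverable _ _ leM') => i j ai bj.
  apply: (eqM (i, j)); apply: mem_hyperbola ai bj => //.
  by rewrite (size_in_words in_rho).
have far4 : far (@brs_le n m s d) (4 * (eps / 4))%R M.
  by rewrite (_ : 4 * (eps / 4) = eps) //; field.
(* The resulting bound is [(2 * 2 ^ d + 2) / (16 * 2 ^ d) <= 1 / 4]. *)
apply: le_trans (pass_prob_le (k := (2 ^ d).*2.+2) block_miss_le _ far4 _ _ _ _ _) _;
  rewrite ?add0n ?addn0 //; first by lra.
have p_ge1 : 1 <= (2 ^ d)%:R :> R by rewrite ler1n expn_gt0.
have half : (2 ^ d)%:R * 2^-1 ^+ d = 1 :> R.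
  by rewrite natrX -exprMn divff ?expr1n // pnatr_eq0.
rewrite exprD -[(2 ^ d).*2.+2]addn2 -muln2 natrD natrM.
have h_ge0 : 0 <= 2^-1 ^+ d :> R by rewrite exprn_ge0 // invr_ge0.
move: p_ge1 half h_ge0; move: (2 ^ d)%:R (2^-1 ^+ d) => p h p_ge1 half h_ge0.
have : h <= 1 by nra.
have -> : 2^-1 ^+ 4 = 16^-1 :> R by field.
by nra.
Qed.

Lemma sample_tester : (0 < n)%N -> (0 < m)%N ->
  one_sided_tester (@brs_le n m s d) eps
    (consistency_tester sample_queries (@brs_le n m s d)).
Proof.
move=> n_gt0 m_gt0; have qs_neq0 := sample_queries_neq0 n_gt0 m_gt0.
split; first exact: consistency_tester_valid.
split; [by move=> M; apply: consistency_tester_complete | exact: sample_tester_sound].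
Qed.

(** * Counting queries *)

Lemma TboundE :
  Tbound d s eps = (324 * (d ^ 2 * binom_le d s * 2 ^ d)%:R / eps ^+ 2)%R.
Proof.
rewrite /Tbound RdivE RmultE; congr (_ * _ / _).
by rewrite -[324 in RHS]INRE INR_IZR_INZ.
Qed.

Lemma Tbound_ge : (0 < d)%N -> 324 * (d ^ 2)%:R / eps <= Tbound d s eps /\
  3 * width%:R <= Tbound d s eps.
Proof.
have /andP[eps0 eps1] := eps01; move=> d_gt0; rewrite TboundE.
have ieps : 1 <= eps^-1 by rewrite invf_ge1 // ltW.
rewrite -exprVn.
have b1 : (0 < binom_le d s * 2 ^ d)%N by rewrite muln_gt0 binom_le_gt0 expn_gt0.
rewrite -mulnA !(natrM _ _ (binom_le d s * 2 ^ d)) (natrX _ d 2).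
have d1 : 1 <= d%:R :> R by rewrite ler1n.
move: (binom_le d s * 2 ^ d)%N b1 => b; rewrite -(ler1n R).
move: (b%:R : R) (d%:R : R) eps^-1 ieps d1 => B D e e1 D1 B1.
have D2 : 1 <= D ^+ 2 by rewrite exprn_ege1.
have e2 : e <= e ^+ 2 by rewrite ler_eXnr.
have D2B : D ^+ 2 <= D ^+ 2 * B by rewrite ler_peMr // (le_trans _ D2).
have BD2 : B <= D ^+ 2 * B by rewrite ler_peMl // (le_trans _ B1).
have e2_ge1 : 1 <= e ^+ 2 by rewrite exprn_ege1.
have le1 : D ^+ 2 * e <= D ^+ 2 * B * e ^+ 2 by rewrite ler_pM //; lra.
have le2 : D ^+ 2 * B <= D ^+ 2 * B * e ^+ 2 by rewrite ler_peMr //; lra.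
split; lra.
Qed.

(** The 1 left by the harmonic sum is absorbed because [3 * width <= Tbound d s eps] and
    [exp 1 <= 3]. *)
Lemma ln_Tbound_ge : (0 < d)%N -> 1 + ln width%:R <= ln (Tbound d s eps).
Proof.
move=> d_gt0; have [_ le_T] := Tbound_ge d_gt0.
have : 0 < width%:R :> R by rewrite ltr0n !muln_gt0 binom_le_gt0 expn_gt0.
move: (width%:R : R) le_T => w le_T w_gt0.
have w3_gt0 : 0 < 3 * w by lra.
apply: (@le_trans _ _ (ln (3 * w)%R)); last first.
  by apply/RleP/ln_monotone; [apply/RltP | apply/RleP].
have -> : ln (3 * w)%R = ln 3%:R%R + ln w by apply: ln_mult; apply/RltP.
rewrite lerD2r -[leLHS]ln_exp; apply/RleP/ln_monotone; first exact: exp_pos.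
by have := exp_le_3; rewrite -[3%:R in X in _ -> X]INRE INR_IZR_INZ.
Qed.

(** The factors are at most [5 / eps] and [5 * d]. *)
Lemma block_length_le : (0 < d)%N -> block_length%:R <= 25 * d%:R / eps.
Proof.
have /andP[eps0 eps1] := eps01; move=> d_gt0; rewrite /block_length natrM natrD.
have ieps : 1 <= eps^-1 by rewrite invf_ge1 // ltW.
have : (Num.truncn (4 / eps))%:R <= 4 / eps.
  by rewrite truncn_le // divr_ge0 // ltW.
rewrite -[(Num.truncn _).+1]addn1 natrD; move: (Num.truncn _)%:R => k le_k.
have D1 : 1 <= d%:R :> R by rewrite ler1n.
move: (d%:R : R) eps^-1 ieps le_k D1 => D e e1 le_k D1.
rewrite (_ : 25 * D * e = (5 * e) * (5 * D)); last by ring.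
apply: le_trans (_ : (5 * e) * (D + 4) <= _); first by rewrite ler_wpM2r //; lra.
by rewrite ler_wpM2l //; lra.
Qed.

Lemma sample_queries_le (P : bmatrix n m -> Prop) : (0 < d)%N ->
  queries_le (consistency_tester sample_queries P)
    (8 * Tbound d s eps * ln (Tbound d s eps))%R.
Proof.
move=> d_gt0 k /=; have /andP[eps0 eps1] := eps01.
have /allpairsP[[rho kappa] /= [in_rho in_kappa ->]] :
  nth [::] sample_queries k \in sample_queries by apply: mem_nth.
have size_rho : {in rho, forall r, size r = block_length}.
  by move=> r /(words_sub in_rho) /size_in_words.
have size_kappa : {in kappa, forall c, size c = block_length}.
  by move=> c /(words_sub in_kappa) /size_in_words.
have := size_hyperbola width size_rho size_kappa; rewrite -(ler_nat R).
move/le_trans; apply; rewrite natrM natrX.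
have w_gt0 : (0 < width)%N by rewrite !muln_gt0 binom_le_gt0 expn_gt0.
have lnw_ge0 := ln_natr_ge0 w_gt0.
apply: le_trans (ler_wpM2l _ (sum_divn_le_ln w_gt0)) _; first exact: sqr_ge0.
rewrite mulrA ler_pM ?ln_Tbound_ge ?mulr_ge0 ?sqr_ge0 ?addr_ge0 ?ler0n //.
rewrite TboundE -mulnA !(natrM _ _ (binom_le d s * 2 ^ d)) (natrX _ d 2).
have len2 : block_length%:R ^+ 2 <= (25 * d%:R / eps) ^+ 2.
  by rewrite lerXn2r ?nnegrE ?block_length_le ?divr_ge0 ?mulr_ge0 ?ler0n // ltW.
move: (ler0n R (binom_le d s * 2 ^ d)) (block_length%:R ^+ 2) len2.
move: ((binom_le d s * 2 ^ d)%:R) => B B_ge0 l2 len2.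
apply: le_trans (ler_wpM2r _ len2) _; first by rewrite mulr_ge0.
rewrite -exprVn exprMn exprMn.
have : 0 <= d%:R ^+ 2 * B * eps^-1 ^+ 2.
  by apply: mulr_ge0 (sqr_ge0 _); apply: mulr_ge0 (sqr_ge0 _) B_ge0.
(* The constants fit: [25 ^ 2 * 4 = 2500 <= 8 * 324]. *)
by move: (eps^-1 ^+ 2) (d%:R ^+ 2) => e2 D2; lra.
Qed.

End Sampling.

Lemma full_query_le d s C eps n m : (0 < d)%N -> 0 < eps < 1 -> 1 <= C ->
    eps * (n * m)%:R <= 2 * (d ^ 2)%:R -> forall P : bmatrix n m -> Prop,
  queries_le (consistency_tester [:: enum {: 'I_n * 'I_m}] P)
    (C * Tbound d s eps * ln (Tbound d s eps))%R.
Proof.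
move=> d_gt0 eps01 C_ge1 small P [[|//] lt_k] /=; have /andP[eps0 eps1] := eps01.
rewrite -cardE card_prod !card_ord.
have [le_T _] := Tbound_ge s eps01 d_gt0.
have lnT_ge1 : 1 <= ln (Tbound d s eps).
  apply: le_trans (ln_Tbound_ge s eps01 d_gt0); rewrite lerDl ln_natr_ge0 //.
  by rewrite !muln_gt0 binom_le_gt0 expn_gt0.
have le_nm : (n * m)%:R <= 2 * (d ^ 2)%:R / eps by rewrite ler_pdivlMr // mulrC.
have d2e : 0 <= (d ^ 2)%:R / eps by rewrite divr_ge0 ?ler0n // ltW.
have T_ge0 : 0 <= Tbound d s eps by lra.
apply: le_trans le_nm _; rewrite -[leLHS]mulr1; apply: ler_pM => //; try lra.
apply: le_trans (_ : Tbound d s eps <= _); first by lra.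
by rewrite ler_peMl.
Qed.

(** Halving [eps] multiplies [Tbound] by 4, and [4 <= T] gives [ln (4 * T) <= 2 * ln T]; hence
    [64 = 8 * 4 * 2]. *)
Lemma Tbound_half d s eps : (0 < d)%N -> 0 < eps < 1 ->
  8 * Tbound d s (eps / 2)%R * ln (Tbound d s (eps / 2)%R)
    <= 64 * Tbound d s eps * ln (Tbound d s eps).
Proof.
move=> d_gt0 eps01; have /andP[eps0 eps1] := eps01.
have -> : Tbound d s (eps / 2)%R = 4 * Tbound d s eps.
  by rewrite !TboundE; field; rewrite gt_eqF.
have [_] := Tbound_ge s eps01 d_gt0.
have : 1 <= (binom_le d s * 2 ^ d)%:R :> R.
  by rewrite ler1n muln_gt0 binom_le_gt0 expn_gt0.
rewrite (natrM _ 4); move: (Tbound d s eps) ((binom_le d s * 2 ^ d)%:R) => T B B1 leT.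
have T_gt0 : 0 < T by lra.
have T4_gt0 : 0 < 4 * T by lra.
have lnT : ln (4 * T)%R <= ln T + ln T.
  have <- : ln (T * T)%R = ln T + ln T by apply: ln_mult; apply/RltP.
  by apply/RleP/ln_monotone; [exact/RltP | apply/RleP; rewrite ler_pM2r //; lra].
have -> : 64 * T * ln T = 32 * T * (ln T + ln T) by ring.
rewrite (_ : 8 * (4 * T) = 32 * T); last by ring.
by rewrite ler_wpM2l //; lra.
Qed.

Theorem theorem2 :
  (exists C : R, exists tst : R -> nat -> nat -> forall n m : nat, tester n m,
     forall (s d : nat) (eps : R) (n m : nat),
       (1 <= s)%N -> (1 <= d)%N -> 0 < eps < 1 ->
       queries_le (tst eps d s n m) (C * Tbound d s eps * ln (Tbound d s eps)) /\
       one_sided_tester (@brs_le n m s d) eps (tst eps d s n m)) /\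
  (exists C : R, exists tst : R -> nat -> nat -> forall n m : nat, tester n m,
     forall (s d : nat) (eps : R) (n m : nat),
       (1 <= s)%N -> (1 <= d)%N -> 0 < eps < 1 ->
       queries_le (tst eps d s n m) (C * Tbound d s eps * ln (Tbound d s eps)) /\
       one_sided_tester (@brs_eq n m s d) eps (tst eps d s n m)).
Proof.
split.
  exists (8%:R), (fun eps d s n m => consistency_tester
    (* A matrix without entries offers no blocks to draw, so sampling would have no outcome at
       all. *)
    (if (0 < n * m)%N then sample_queries eps d s n m
     else [:: enum {: 'I_n * 'I_m}]) (@brs_le n m s d)).
  move=> s d eps n m s_gt0 d_gt0 eps01; have /andP[eps0 eps1] := eps01.
  case: posnP => [nm0|]; last rewrite muln_gt0 => /andP[n_gt0 m_gt0].
    split; last by apply: full_query_tester; apply: ltW.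
    by apply: full_query_le; rewrite ?nm0 ?mulr0 ?mulr_ge0 ?ler0n ?ler1n.
  by split; [exact: sample_queries_le | exact: sample_tester].
exists (64%:R), (fun eps d s n m => consistency_tester
  (* Above this threshold the [d ^ 2] planted entries use less than half of the distance. *)
  (if 2 * (d ^ 2)%:R < eps * (n * m)%:R then sample_queries (eps / 2)%R d s n m
   else [:: enum {: 'I_n * 'I_m}]) (@brs_eq n m s d)).
move=> s d eps n m s_gt0 d_gt0 eps01; have /andP[eps0 eps1] := eps01.
case: ltP => [large|small]; last first.
  split; last by apply: full_query_tester; apply: ltW.
  by apply: full_query_le => //; rewrite ler1n.
have half01 : 0 < eps / 2 < 1 by apply/andP; lra.
have /andP[n_gt0 m_gt0] : (0 < n)%N && (0 < m)%N.
  rewrite -muln_gt0 lt0n; apply/eqP=> nm0; move: large; rewrite nm0 mulr0.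
  by rewrite ltNge mulr_ge0 ?ler0n.
have qs_neq0 := @sample_queries_neq0 (eps / 2)%R d s _ _ n_gt0 m_gt0.
split=> [k|].
  apply: le_trans (Tbound_half s d_gt0 eps01).
  exact: (sample_queries_le half01 d_gt0 k).
split; first exact: consistency_tester_valid.
split=> [M|M farM]; first exact: consistency_tester_complete.
(* If no matrix has rank exactly [d], no answers are consistent and acceptance has probability 0. *)
have [[M0 eqM0]|none] := pselect (exists M0 : bmatrix n m, brs_eq s d M0); last first.
  rewrite accept_prob_consistency; apply: avg_const_le => [|q _]; first by lra.
  by rewrite asboolF ?divr_ge0 // => -[M' eqM' _]; apply: none; exists M'.
have far_le := far_brs_eq_brs_le s_gt0 d_gt0 (ltW large) eqM0 farM.
(* Answers consistent with rank exactly [d] are consistent with rank at most [d], so soundness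
   carries over. *)
apply: le_trans (sample_tester_sound half01 far_le); apply: accept_prob_sub.
by move=> M' [cov _]; apply/brs_leP.
Qed.
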